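(* Let $X$ be a set and let $\mathcal{H}\subseteq 2^X$ be VC finite. Then for every $\epsilon$ with $\frac12<\epsilon<1$ there exists $n=n(\epsilon)\in\omega$ such that for every injective sample $f:\omega\to X$ and every $x\in 2^{f([n])}$: if $x\in\mathcal{H}{\upharpoonright}_{f([n])}$, then $(\mathcal{H},f,n)$ is severely surprising at level $\epsilon$ with observed data $x$.
   Context: $2^X$ is the set of functions $X\to\{0,1\}$; a hypothesis is a subset $\mathcal{H}\subseteq 2^X$, and $\mathcal{H}^c=2^X\setminus\mathcal{H}$. For $X_0\subseteq X$, $\mathcal{H}{\upharpoonright}_{X_0}=\{h{\upharpoonright}_{X_0}: h\in\mathcal{H}\}$; $\mathcal{H}$ shatters $X_0$ if $\mathcal{H}{\upharpoonright}_{X_0}=2^{X_0}$. $\mathcal{H}$ is VC finite if there is $d\in\omega$ such that every set shattered by $\mathcal{H}$ has at most $d$ elements. A sample of $X$ is an injective function $f:\omega\to X$. Write $[n]=\{0,\dots,n-1\}$. The surprise of $\mathcal{H}$ along $f$ at stage $n$ is $$S(\mathcal{H},f,n)=1-\frac{|\mathcal{H}{\upharpoonright}_{f([n])}|}{2^{|f([n])|}}.$$ For $\epsilon>0$ and observed data $x\in 2^{f([n])}$, $(\mathcal{H},f,n)$ is severely surprising at level $\epsilon$ if $x\in\mathcal{H}{\upharpoonright}_{f([n])}$, $S(\mathcal{H},f,n)>1-\epsilon$, and $S(\mathcal{H},f,n)>S(\mathcal{H}^c,f,n)$. *)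

(* Defs.v *)
From mathcomp Require Import all_boot all_order all_algebra finmap.
From mathcomp Require Import boolp classical_sets functions cardinality reals.

Set Implicit Arguments.
Unset Strict Implicit.
Unset Printing Implicit Defensive.

Import Order.TTheory GRing.Theory Num.Theory.

Local Open Scope classical_set_scope.
Local Open Scope card_scope.
Local Open Scope ring_scope.

(* Number of elements of a finite set; fset_set makes it 0 on infinite sets,
   but it is only applied below to subsets of f([n]) and of 2^{f([n])}. *)
Definition ncard (T : Type) (A : set T) : nat :=
  #|` fset_set (A : set {classic T})|.

Definition restr (X : Type) (H : set (X -> bool)) (X0 : set X) :
    set (X0 -> bool) :=
  sigL X0 @` H.
Arguments restr {X} H X0 _.

Definition shatters (X : Type) (H : set (X -> bool)) (X0 : set X) : Prop :=
  restr H X0 = setT.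

Definition VC_finite (X : Type) (H : set (X -> bool)) : Prop :=
  exists d : nat, forall X0 : set X, shatters H X0 -> X0 #<= `I_d.

Definition surprise (R : realType) (X : Type) (H : set (X -> bool))
    (f : nat -> X) (n : nat) : R :=
  1 - (ncard (restr H (f @` `I_n)))%:R / 2 ^+ ncard (f @` `I_n).

Definition severely_surprising (R : realType) (X : Type)
    (H : set (X -> bool)) (f : nat -> X) (n : nat) (eps : R)
    (x : (f @` `I_n) -> bool) : Prop :=
  [/\ restr H (f @` `I_n) x,
      1 - eps < surprise R H f n &
      surprise R (~` H) f n < surprise R H f n].
Arguments severely_surprising {R X} H f n eps x.

(* Main.v *)
Require Import Defs.
From mathcomp Require Import all_boot all_order all_algebra.
From mathcomp Require Import zify.
From mathcomp Require Import boolp classical_sets functions cardinality reals.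

(** The theorem holds because the number of traces of a VC finite class on an
    n-point set is eventually less than half of 2^n, uniformly in the set. Once
    2 |H_F| < 2^n holds for F = f([n]), both strict inequalities follow: the
    surprise of H exceeds 1/2 > 1 - eps, and since every function on F is a
    trace of H or of its complement, the complement has at least
    2^n - |H_F| > |H_F| traces, hence a smaller surprise.

    A product argument bounds |H_F|. If no set of m = d + 1 points is shattered,
    cut F into k blocks of m points. On each block some pattern is missing, so
    that at most 2^m - 1 patterns occur there, and |H_F| <= (2^m - 1)^k
    (lemma [card_traces_blocks]). Against 2^n = (2^m)^k this loses a constant
    factor per block, and k = 2^m blocks already bring the ratio below 1/2
    (lemma [double_expn_pred]). The resulting n = m 2^m depends on d alone.

    Traces are counted in finite types: a finite set of points is presented by
    an injective enumeration e : I -> X, and traces become elements of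
    {ffun I -> bool} (lemma [ncard_restr]). *)

Set Implicit Arguments.
Unset Strict Implicit.
Unset Printing Implicit Defensive.

Import Order.TTheory GRing.Theory Num.Theory.

Local Open Scope classical_set_scope.
Local Open Scope ring_scope.

Lemma card_eq_range (I : finType) (X : Type) (e : I -> X) :
  injective e -> (range e #= `I_#|I|)%card.
Proof.
move=> e_inj.
have -> : range e = range (fun j : 'I_#|I| => e (enum_val j)).
  apply/seteqP; split => [_ [i _ <-] | _ [j _ <-]]; last by exists (enum_val j).
  by exists (enum_rank i); rewrite //= enum_rankK.
apply: (card_eq_trans (B := [set: 'I_#|I|])).
  by apply: inj_card_eq => i j _ _ /= /e_inj/enum_val_inj.
by rewrite card_eq_sym; exact: card_II.
Qed.

Lemma card_eq_finset (U : finType) (B : {set U}) :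
  ([set` B] #= `I_#|B|)%card.
Proof.
have -> : [set` B] = range (fun u : {u | u \in B} => val u).
  apply/seteqP; split => [u /= uB | _ [u _ <-]]; last exact: valP.
  by exists (exist _ u uB).
by rewrite -card_sig; apply: card_eq_range; exact: val_inj.
Qed.

Lemma ncard_range (I : finType) (X : Type) (e : I -> X) :
  injective e -> ncard (range e) = #|I|.
Proof. by move=> e_inj; apply: card_fset_set; exact: card_eq_range. Qed.

Definition traces (X : Type) (H : set (X -> bool)) (I : finType) (e : I -> X) :
    {set {ffun I -> bool}} :=
  [set t | `[< exists2 h, H h & t = [ffun i => h (e i)] >]].

Lemma in_traces (X : Type) (H : set (X -> bool)) (I : finType) (e : I -> X) t :
  reflect (exists2 h, H h & t = [ffun i => h (e i)]) (t \in traces H e).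
Proof. by rewrite inE; exact: asboolP. Qed.

(** Reading a function on [range e] along [e] is injective because [e] covers
    its range, so the traces on [range e] can be counted as patterns on [I]. *)
Lemma ncard_restr (X : Type) (H : set (X -> bool)) (I : finType) (e : I -> X) :
  ncard (restr H (range e)) = #|traces H e|.
Proof.
have eI i : e i \in range e by rewrite inE; exists i.
pose g (y : range e -> bool) : {ffun I -> bool} :=
  [ffun i => y (exist _ (e i) (eI i))].
have g_inj : injective g.
  move=> y z /ffunP yz; apply/funext => -[u uF].
  have [i _ iu] := set_mem uF; subst u.
  by have := yz i; rewrite !ffunE (bool_irrelevance (eI i) uF).
apply: card_fset_set; apply: card_eq_trans (card_eq_finset _).
have -> : [set` traces H e] = g @` restr H (range e).
  apply/seteqP; split => [t /in_traces[h Hh ->] | t /= [_ [h Hh <-] <-]].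
    by exists (sigL (range e) h); [exists h | apply/ffunP => i; rewrite !ffunE].
  by apply/in_traces; exists h => //; apply/ffunP => i; rewrite !ffunE.
by rewrite card_eq_sym; apply: inj_card_eq; exact: in2W.
Qed.

(** Over an injective enumeration every pattern extends to a function on [X],
    which lies in [H] or in its complement. *)
Lemma leq_card_traces_setC (X : Type) (H : set (X -> bool)) (I : finType)
    (e : I -> X) :
  injective e -> (2 ^ #|I| <= #|traces H e| + #|traces (~` H) e|)%N.
Proof.
move=> e_inj; rewrite -[X in (X ^ _)%N]card_bool -card_ffun -cardsT.
apply: leq_trans (leq_card_setU _ _); apply/subset_leq_card/fintype.subsetP => t _.
(* Extend t by false outside the range of e. *)
pose h x := `[< exists2 i, e i = x & t i >].
have th : t = [ffun i => h (e i)].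
  apply/ffunP => i; rewrite ffunE; apply/idP/asboolP => [ti|]; first by exists i.
  by case=> j /e_inj ->.
by rewrite inE; have [Hh|Hh] := pselect (H h); apply/orP; [left|right];
   apply/in_traces; exists h.
Qed.

(** If every pattern on I were a trace along e, the range of e would be
    shattered. *)
Lemma exists_missing_trace (X : Type) (H : set (X -> bool)) (d : nat)
    (I : finType) (e : I -> X) :
  (forall X0, shatters H X0 -> X0 #<= `I_d)%card ->
  injective e -> (d < #|I|)%N -> exists t, t \notin traces H e.
Proof.
move=> Hd e_inj dI; apply: contrapT => all_t.
have {}all_t t : t \in traces H e.
  by apply: contrapT => /negP nt; apply: all_t; exists t.
have /Hd : shatters H (range e).
  apply/seteqP; split => // y _.
  have eI i : e i \in range e by rewrite inE; exists i.
  have /in_traces[h Hh /ffunP yh] :=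
    all_t [ffun i => y (exist _ (e i) (eI i))].
  exists h => //; apply/funext => -[u uF].
  have [i _ iu] := set_mem uF; subst u.
  by have := yh i; rewrite !ffunE (bool_irrelevance (eI i) uF).
by rewrite (card_le_eql (card_eq_range e_inj)) card_le_II leqNgt dI.
Qed.

(** Currying a trace splits it into one pattern per block, and a block always
    avoids its missing pattern, which leaves [2 ^ #|J| - 1] choices. *)
Lemma card_traces_blocks (X : Type) (H : set (X -> bool)) (d : nat)
    (K J : finType) (e : K * J -> X) :
  (forall X0, shatters H X0 -> X0 #<= `I_d)%card ->
  injective e -> (d < #|J|)%N ->
  (#|traces H e| <= (2 ^ #|J|).-1 ^ #|K|)%N.
Proof.
move=> Hd e_inj dJ.
have missing k : exists t, t \notin traces H (fun j => e (k, j)).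
  by apply: exists_missing_trace Hd _ dJ => i j /e_inj[].
pose b k := xchoose (missing k).
pose curry (t : {ffun K * J -> bool}) : {ffun K -> {ffun J -> bool}} :=
  [ffun k => [ffun j => t (k, j)]].
have curry_inj : injective curry.
  move=> s t /ffunP st; apply/ffunP => -[k j].
  by have := st k; rewrite !ffunE => /ffunP/(_ j); rewrite !ffunE.
rewrite -(card_imset _ curry_inj).
have -> : ((2 ^ #|J|).-1 ^ #|K| = #|family (fun k => predC1 (b k))|)%N.
  rewrite card_family foldrE big_image /=.
  rewrite (eq_bigr (fun=> (2 ^ #|J|).-1)) ?prod_nat_const // => k _.
  by rewrite cardC1 card_ffun card_bool.
apply/subset_leq_card/fintype.subsetP => _ /imsetP[t /in_traces[h Hh ->] ->].
apply/familyP => k; rewrite inE; apply/eqP => hb.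
have /negP[] := xchooseP (missing k); rewrite -/(b k) -hb.
by apply/in_traces; exists h => //; apply/ffunP => j; rewrite !ffunE.
Qed.

(** Bernoulli's inequality [(1 + 1/a) ^ a >= 2], with one further factor
    [1 + 1/a] making it strict. *)
Lemma double_expn_pred (a : nat) : (0 < a)%N -> (2 * a ^ a.+1 < a.+1 ^ a.+1)%N.
Proof.
move=> a0.
have bernoulli n : (a ^ n + n * a ^ n.-1 <= a.+1 ^ n)%N.
  elim: n => [|[|n] IHn] //; first by rewrite !expn1 mul1n addn1.
  rewrite [leqRHS]expnS; apply: leq_trans (leq_mul (leqnn a.+1) IHn).
  rewrite !expnS /=; nia.
have := bernoulli a.+1 => /=.
have : (0 < a ^ a)%N by rewrite expn_gt0 a0.
rewrite [(a ^ a.+1)%N]expnS; nia.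
Qed.

Theorem proposition2p6 (R : realType) (X : Type) (H : set (X -> bool))
    (H_VC : VC_finite H) (eps : R) (eps_gt : 2^-1 < eps) (eps_lt1 : eps < 1) :
  exists n : nat, forall f : nat -> X, injective f ->
    forall x : (f @` `I_n) -> bool,
      restr H (f @` `I_n) x -> severely_surprising H f n eps x.
Proof.
have [d Hd] := H_VC; pose J := 'I_d.+1; pose K := {ffun J -> bool}.
(* There is one block of d + 1 points for each of the 2 ^ (d + 1) patterns on
   J; letting the patterns K themselves index the blocks makes #|K| blocks. *)
exists #|{: K * J}| => f f_inj x Hx.
pose e (p : K * J) := f (enum_rank p).
have e_inj : injective e by move=> p q /f_inj/val_inj/enum_rank_inj.
have Fe : f @` `I_#|{: K * J}| = range e.
  apply/seteqP; split => [_ [i /= i_lt <-] | _ [p _ <-]]; last first.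
    by exists (enum_rank p) => //=; exact: ltn_ord.
  by exists (enum_val (Ordinal i_lt)); rewrite // /e enum_valK.
have half : (2 * #|traces H e| < 2 ^ #|{: K * J}|)%N.
  have dJ : (d < #|J|)%N by rewrite card_ord.
  have cK : #|K| = (2 ^ #|J|)%N by rewrite card_ffun card_bool.
  have blk : (2 ^ #|J|).-1.+1 = (2 ^ #|J|)%N by rewrite prednK ?expn_gt0.
  apply: leq_ltn_trans (leq_mul (leqnn 2) (card_traces_blocks Hd e_inj dJ)) _.
  rewrite card_prod [(#|K| * _)%N]mulnC expnM cK -{2 3 4}blk.
  apply: double_expn_pred.
  by rewrite -ltnS blk (leq_exp2l 1) ?card_ord.
have compl := leq_card_traces_setC H e_inj.
(* Since eps > 1/2, the threshold 1 - eps is below 1/2. *)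
split=> //; rewrite /surprise Fe !ncard_restr (ncard_range e_inj).
  rewrite ltrD2l ltrN2 (lt_trans _ eps_gt)// ltr_pdivrMr ?exprn_gt0//.
  rewrite mulrC ltr_pdivlMr// mulrC -natrX -natrM ltr_nat.
  exact: half.
rewrite ltrD2l ltrN2 ltr_pM2r ?invr_gt0 ?exprn_gt0// ltr_nat.
by have := leq_trans half compl; rewrite mul2n -addnn ltn_add2l.
Qed.
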